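(* Let $(p_n)_{n\ge 0}$ be a sequence in $[0,1]$ and consider the associated long-range oriented percolation model on the oriented graph $\mathcal{G}$ with vertex set $\mathbb{Z}\times\mathbb{Z}_+$, and its truncations $P^K$, $K\in\{1,2,\dots\}$. If $\sum_{n} p_n^2=\infty$, then the truncation question has an affirmative answer, i.e. there exists a positive integer $K$ such that $P^K\{(0,0)\rightsquigarrow\infty\}>0$. Moreover, $$\lim_{K\to\infty}P^K\{(0,0)\rightsquigarrow\infty\}=1.$$
   Context: Here $\mathbb{Z}_+=\{0,1,2,\dots\}$. The oriented graph $\mathcal{G}$ (case $d=1$) has vertex set $\mathbb{Z}\times\mathbb{Z}_+$ and set of oriented bonds $\{\langle (x,m),(x+n,m+1)\rangle : x\in\mathbb{Z},\ m\in\mathbb{Z}_+,\ n\in\mathbb{Z}\}$, each bond being oriented from $(x,m)$ to $(x+n,m+1)$. Under the product probability measure $P$, each bond $\langle (x,m),(x+n,m+1)\rangle$ is open with probability $p_{|n|}$ and closed otherwise, independently of all other bonds. For a positive integer $K$, the truncated measure $P^K$ is the product measure defined in the same way with $(p_n)_n$ replaced by $(p_n^K)_n$, where $p_n^K=p_n$ if $n\le K$ and $p_n^K=0$ if $n>K$. The event $\{(0,0)\rightsquigarrow\infty\}$ is the set of configurations in which there exists an infinite oriented path of open bonds starting from $(0,0)$. *)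

(* Defs.v *)
From HB Require Import structures.
From mathcomp Require Import all_boot all_order all_algebra.
From mathcomp Require Import all_classical all_reals all_analysis.
From mathcomp Require Import ring lra.

Set Implicit Arguments.
Unset Strict Implicit.
Unset Printing Implicit Defensive.

Import Order.TTheory GRing.Theory Num.Theory.
Import numFieldNormedType.Exports.

Local Open Scope classical_set_scope.
Local Open Scope ring_scope.

Definition vertex : Type := (int * nat)%type.

(* [(x, m, n)] is the oriented bond from [(x, m)] to [(x + n, m + 1)]. *)
Definition bond : Type := (int * nat * int)%type.

Definition bond_src (e : bond) : vertex := (e.1.1, e.1.2).

Definition bond_tgt (e : bond) : vertex := (e.1.1 + e.2, e.1.2.+1).

Definition bond_len (e : bond) : nat := `|e.2|%N.

Definition bond_events : set (set (bond -> bool)) :=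
  [set A : set (bond -> bool) |
    exists e : bond, A = [set w : bond -> bool | w e]].

(* The configuration space {0,1}^bond with its product sigma-algebra; [w e]
   means that the bond [e] is open in [w]. *)
Definition config := g_sigma_algebraType bond_events.

(* [P] is the product measure under which a bond of displacement [n] is open
   with probability [q `|n|]. The cylinders form a pi-system generating the
   sigma-algebra, so their probabilities determine [P]; existence is
   [bond_percolation_exists] below. *)
Definition is_bond_percolation (R : realType) (q : nat -> R)
    (P : probability config R) : Prop :=
  forall (s : seq bond) (b : bond -> bool), uniq s ->
    P [set w : config | forall e, e \in s -> w e = b e] =
    (\prod_(e <- s) (if b e then q (bond_len e) else 1 - q (bond_len e)))%:E.

Definition truncation (R : realType) (p : nat -> R) (K n : nat) : R :=
  if (n <= K)%N then p n else 0.

Definition percolates : set config :=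
  [set w : config | exists v : nat -> vertex, v 0%N = (0, 0%N) /\
    forall i, exists e : bond,
      [/\ bond_src e = v i, bond_tgt e = v i.+1 & w e]].

(* Since every vertex has infinitely many outgoing bonds, [percolates] is an
   analytic set which need not belong to the product sigma-algebra. It is
   however measurable for the completion of every percolation measure; in the
   truncated case, up to the null event that some bond longer than the
   truncation level is open, it is the intersection over [n] of the events
   that some open path of length [n] starts at the origin. Its probability is
   therefore taken in the completion of [P], which agrees with [P] on the
   product sigma-algebra. *)
Definition completed_prob (R : realType) (P : probability config R)
    (A : set config) : \bar R :=
  @completed_measure_extension _ _ _ P A.

(* Existence of the product measure: a uniform point of [0, 1[ is encoded by
   a sequence of bits with prescribed biases [u n], obtained by successively
   cutting the current interval [l, r[ at [l + (r - l) * u n]; the product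
   measure is the law of this sequence, indexed by [pickle]. *)
Section existence.
Variable R : realType.
Variable u : nat -> R.
Hypothesis u01 : forall n, 0 <= u n <= 1.

(* The bit of index [n + k] of [x], the bits of index smaller than [n] having
   located [x] in [l, r[. *)
Fixpoint bit (k n : nat) (l r x : R) : bool :=
  let m := l + (r - l) * u n in
  if k is k'.+1 then
    if x < m then bit k' n.+1 l m x else bit k' n.+1 m r x
  else x < m.

Lemma measurable_bit k n l r : measurable [set x : R | bit k n l r x].
Proof.
elim: k n l r => [|k IH] n l r /=.
  have -> : [set x : R | x < l + (r - l) * u n] =
      `]-oo, (l + (r - l) * u n)[%classic.
    by apply/seteqP; split => x /=; rewrite in_itv.
  exact: measurable_itv.
set m := l + _.
have -> : [set x : R | if x < m then bit k n.+1 l m x else bit k n.+1 m r x] =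
  (`]-oo, m[ `&` [set x | bit k n.+1 l m x]) `|`
  (`[m, +oo[ `&` [set x | bit k n.+1 m r x]).
  apply/seteqP; split => x /=; rewrite !in_itv /= ?andbT; case: ltP => xm.
  - by left.
  - by right.
  - by case=> -[].
  - by case=> -[].
by apply: measurableU; apply: measurableI.
Qed.

Definition weight (S b : nat -> bool) i : R :=
  if S i then (if b i then u i else 1 - u i) else 1.

Lemma bit_cylinder (S b : nat -> bool) k n l r : l <= r ->
  let A := `[l, r[ `&`
     [set x | forall i, (i < k)%N -> S (n + i)%N -> bit i n l r x = b (n + i)%N]
  in measurable A /\
  lebesgue_measure A = ((r - l) * \prod_(i < k) weight S b (n + i))%:E.
Proof.
elim: k n l r => [|k IH] n l r lr /=.
  have -> : `[l, r[ `&` [set x | forall i, (i < 0)%N -> S (n + i)%N ->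
      bit i n l r x = b (n + i)%N] = `[l, r[%classic.
    by apply/seteqP; split=> x /=; [case|].
  split=> //; rewrite lebesgue_measure_itv /= big_ord0 mulr1 lte_fin.
  case: ltP => // rl; have -> : r = l by apply/eqP; rewrite eq_le lr rl.
  by rewrite subrr.
have /andP[u0 u1] := u01 n.
pose m := l + (r - l) * u n.
have lm : l <= m by rewrite /m; nra.
have mr : m <= r by rewrite /m; nra.
pose C l r := `[l, r[%classic `&` [set x | forall i, (i < k)%N ->
  S (n.+1 + i)%N -> bit i n.+1 l r x = b (n.+1 + i)%N].
pose D (c : bool) (A : set R) := if S n ==> (c == b n) then A else set0.
have mD c A : measurable A -> measurable (D c A) by rewrite /D; case: ifP.
have [mC1 C1E] := IH n.+1 _ _ lm; have [mC2 C2E] := IH n.+1 _ _ mr.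
have -> : `[l, r[ `&` [set x | forall i, (i < k.+1)%N -> S (n + i)%N ->
    bit i n l r x = b (n + i)%N] = D true (C l m) `|` D false (C m r).
  apply/seteqP; split => x /=; rewrite !in_itv /= => H.
    case: H => /andP[lx xr] H.
    have [xm|mx] := ltP x m; [left|right].
      have H0 : S n ==> (true == b n).
        apply/implyP => Sn; have := H 0%N isT; rewrite addn0 => /(_ Sn) /=.
        by rewrite -/m xm => ->.
      rewrite /D H0; split => /=; first by rewrite in_itv /= lx xm.
      move=> i ik; rewrite addSnnS => Si; have := H i.+1 ik Si => /=.
      by rewrite -/m xm.
    have H0 : S n ==> (false == b n).
      apply/implyP => Sn; have := H 0%N isT; rewrite addn0 => /(_ Sn) /=.
      by rewrite -/m ltNge mx => /= ->.
    rewrite /D H0; split => /=; first by rewrite in_itv /= mx xr.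
    move=> i ik; rewrite addSnnS => Si; have := H i.+1 ik Si => /=.
    by rewrite -/m ltNge mx.
  move: H; rewrite /D => -[]; case: ifPn => // H0 [] /=;
    rewrite in_itv /= => /andP[a c] H; split.
  - by rewrite a (lt_le_trans c).
  - case=> [|i] ik; rewrite ?addn0 => Si /=; rewrite -/m c.
      by apply/eqP/(implyP H0).
    by rewrite -addSnnS H// addSnnS.
  - by rewrite (le_trans lm a).
  - case=> [|i] ik; rewrite ?addn0 => Si /=; rewrite -/m ltNge a /=.
      by apply/eqP/(implyP H0).
    by rewrite -addSnnS H// addSnnS.
split; first by apply: measurableU; exact: mD.
rewrite measureU; [|exact: mD|exact: mD|]; last first.
  apply/seteqP; split => // x /=; rewrite /D.
  case=> + +; case: ifP => // _ [] /= + _; case: ifP => // _ + [] /= + _.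
  rewrite !in_itv /= => /andP[_ xm] /andP[mx _].
  by move: xm; rewrite ltNge mx.
have DE c A : lebesgue_measure (D c A) =
    ((S n ==> (c == b n))%:R%:E * lebesgue_measure A)%E :> \bar R.
  by rewrite /D; case: ifP; rewrite ?mul1e ?mul0e ?measure0.
rewrite /= !DE C1E C2E -!EFinM -EFinD big_ord_recl /= addn0; congr EFin.
under [in RHS]eq_bigr => i _ do rewrite /bump /= add1n -addSnnS.
set p := \prod_(_ < _) _; rewrite /weight /m.
by case: (S n) => /=; [case: (b n) => /=|]; ring.
Qed.

End existence.

Section percolation_exists.
Variable R : realType.
Variable q : nat -> R.
Hypothesis q01 : forall n, 0 <= q n <= 1.

Let u (i : nat) : R := if unpickle i is Some e then q (bond_len e) else 0.

Let u01 i : 0 <= u i <= 1.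
Proof. by rewrite /u; case: unpickle => [e|]; rewrite ?q01 // lexx ler01. Qed.

Definition sample (x : measurableTypeR R) : config := fun e => bit u (pickle (e : bond)) 0 0 1 x.

Lemma measurable_sample : measurable_fun setT sample.
Proof.
apply: (@measurability _ _ _ config _ _ bond_events) => //.
move=> _ [_ [e ->] <-]; rewrite setTI; exact: measurable_bit.
Qed.

HB.instance Definition _ :=
  isMeasurableFun.Build _ _ _ _ sample measurable_sample.

Definition unit_measure : set (measurableTypeR R) -> \bar R :=
  mrestr lebesgue_measure (measurable_itv `[0 : R, 1[).

HB.instance Definition _ := Measure.on unit_measure.

Lemma unit_measureT : unit_measure setT = 1%E.
Proof.
rewrite /unit_measure /mrestr setTI.
by rewrite lebesgue_measure_itv /= lte_fin ltr01 oppr0 adde0.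
Qed.

HB.instance Definition _ :=
  Measure_isProbability.Build _ _ _ unit_measure unit_measureT.

Lemma bond_percolation_exists :
  exists P : probability config R, is_bond_percolation q P.
Proof.
exists (distribution unit_measure sample) => s b us.
rewrite /distribution /pushforward /= /unit_measure /mrestr.
pose t := map pickle s.
have ut : uniq t by rewrite map_inj_uniq//; exact: (pcan_inj pickleK).
pose N := (\max_(i <- t) i).+1.
have tN i : i \in t -> (i < N)%N by move=> it; rewrite ltnS; exact: leq_bigmax_seq.
pose bb i := if unpickle i is Some e then b e else false.
have [_ H] := bit_cylinder u01 (fun i => i \in t) bb N 0 (@ler01 R).
rewrite setIC.
have -> : sample @^-1` [set w : config | forall e : bond, e \in s -> w e = b e]
  = [set x : R | forall i : nat, (i < N)%N -> (0 + i)%N \in t ->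
      bit u i 0 0 1 x = bb (0 + i)%N].
  apply/seteqP; split => x /= xs.
    by move=> i iN; rewrite add0n => /mapP[e es ->]; rewrite /bb pickleK -(xs e es).
  move=> e es; have et : pickle e \in t by exact: map_f.
  by rewrite /sample (xs _ (tN _ et) et) add0n /bb pickleK.
rewrite H subr0 mul1r; congr EFin.
rewrite -(big_mkord xpredT (weight u (fun i => i \in t) bb)) /weight -big_mkcond /=.
rewrite -big_filter (perm_big t); last first.
  apply: uniq_perm => //; first by exact/filter_uniq/iota_uniq.
  move=> i; rewrite mem_filter mem_index_iota /=.
  by apply/andP/idP => [[]//|it]; split => //; exact: tN.
by rewrite big_map; apply: eq_bigr => e _; rewrite /bb /u pickleK.
Qed.

End percolation_exists.

(* Main.v *)
Require Import Defs.
From HB Require Import structures.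
From mathcomp Require Import all_boot all_order all_algebra.
From mathcomp Require Import all_classical all_reals all_analysis.
From mathcomp Require Import zify ring lra.

(** The divergence of the sum of the [p n ^+ 2] makes it almost certain, for a
large truncation level, that a walker can stand still: it goes from [(x, m)] to
[(x, m + 2)] by a loop, a displacement [n] followed by [- n], and the loops of
different lengths are independent, each open with probability [p n ^+ 2]. To
move sideways, fix a displacement [a > 0] with [p a > 0] and use it twice in a
row; this succeeds with a fixed positive probability, so a walker able to stand
still for a long time [2T] finds an occasion to do it.

This is turned into an oriented site percolation on [int * nat]. The site
[(y, s)] stands for the vertex in column [2 a y] at time [2 T s]. It is good if,
during the [T] double steps that follow, a walker can stand still all the time in
its column, using loops that begin to the right; can stand still all the time
in the next column [2 a (y + 1)], using loops that begin to the left; and finds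
an open double displacement from the first column to the second one. From a good
site a walker reaches both [(y, s + 1)] and [(y + 1, s + 1)]. The loops are
taken longer than [a]; all the pairs of bonds involved, at all sites, are then
disjoint ([gbond_inj]), so that the sites are bad independently, with a
probability at most [cut_prob], which is small if [T] is large and the
truncation level is large depending on [T].

It remains to see that percolation from the origin fails with small probability
if bad sites are rare. This is a Peierls argument, with the contours that Toom
used for cellular automata. Call a site doomed if no long path of good sites
leaves it. A doomed site is bad or both of its successors are doomed; unfolding
this recursively attaches to a doomed origin a closed walk through bad sites
([doomed_contour]), and erasing its loops makes these sites distinct. If there
are [m + 1] of them, the closed walk is described by two compositions of [m] into
[m + 1] natural numbers ([doomed_origin]), so that there are at most [16 ^ m]
such walks, and the probability that the origin is doomed is at most the sum of
the [16 ^+ m * cut_prob ^+ m.+1] ([completed_prob_ge]). *)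

Import Order.TTheory GRing.Theory Num.Theory.
Import numFieldNormedType.Exports.

Local Open Scope classical_set_scope.
Local Open Scope ring_scope.

Set Implicit Arguments.
Unset Strict Implicit.

(** * Toom contours of doomed sites *)

Definition site : Type := (int * nat)%type.

Definition up (v : site) : site := (v.1, v.2.+1).
Definition diag (v : site) : site := (v.1 + 1, v.2.+1).

(** No path of [n] sites outside [bad] starts at [v]. *)
Fixpoint doomed (bad : pred site) (n : nat) (v : site) : bool :=
  if n is n'.+1 then bad v || doomed bad n' (up v) && doomed bad n' (diag v)
  else false.

Lemma doomedS bad n v : doomed bad n v -> doomed bad n.+1 v.
Proof.
elim: n v => [//|n IH] v /= /orP[->//|/andP[/IH /= -> /IH /= ->]].
by rewrite orbT.
Qed.

Lemma leq_doomed bad n m v : (n <= m)%N -> doomed bad n v -> doomed bad m v.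
Proof.
by move=> /subnK <-; elim: (m - n)%N => [//|k IH] /IH; exact: doomedS.
Qed.

(** From one bad site of a contour to the next: [ab.2] reversed moves [up], then
one unit to the left, from the [diag] successor of some site to its [up]
successor, then [ab.1] moves [diag]. *)
Definition jump (s : site) (ab : nat * nat) : site :=
  (s.1 + ab.1%:Z - 1, (s.2 + ab.1 - ab.2)%N).

(** A boolean relation, so that loops can be erased by [shorten]; [linkedP]
shows that it means [jump], without truncation of the subtraction. *)
Definition linked : rel site := fun s t =>
  (0 <= t.1 - s.1 + 1) && (t.2%:Z <= s.2%:Z + (t.1 - s.1 + 1)).

Lemma linkedP s t :
  reflect (exists2 ab : nat * nat, t = jump s ab & (ab.2 <= s.2 + ab.1)%N)
          (linked s t).
Proof.
case: s => s1 s2; case: t => t1 t2; rewrite /linked /jump /=.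
apply: (iffP andP) => [[h1 h2]|[[a b] /= [-> ->] h]]; last by split; lia.
exists (`|(t1 - s1 + 1)%R|, (s2 + `|(t1 - s1 + 1)%R| - t2))%N => /=; last lia.
by congr pair; lia.
Qed.

(** The contour is closed: it leaves [v] by moves [diag] to the first bad site
and comes back to [v] from the last one by reversed moves [up]. The closed walk of
a doomed good site [v] is made of those of its two successors: [diag] from [v],
then the walk of [diag v], one unit to the left, then the walk of [up v], and back
down to [v]. *)
Lemma doomed_contour bad n v : doomed bad n v ->
  exists s p, [/\ exists a, s = (v.1 + a%:Z, (v.2 + a)%N),
    path linked s p, exists b, last s p = (v.1, (v.2 + b)%N) & all bad (s :: p)].
Proof.
elim: n v => [//|n IH] v /= /orP[bv|/andP[/IH hl /IH hr]].
  exists v, [::]; split => //=; last by rewrite bv.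
  - by exists 0%N; rewrite addr0 addn0 -surjective_pairing.
  - by exists 0%N; rewrite addn0 -surjective_pairing.
have [s [p [[a sE] sp [b lE] bp]]] := hr.
have [s' [p' [[a' sE'] sp' [b' lE'] bp']]] := hl.
exists s, (p ++ s' :: p'); split.
- by exists a.+1; rewrite sE /=; congr pair; lia.
- rewrite cat_path sp /= sp' andbT; apply/linkedP; exists (a', b).
    by rewrite lE sE' /jump /=; congr pair; lia.
  by rewrite lE /=; lia.
- by exists b'.+1; rewrite last_cat /= lE' /=; congr pair; lia.
- by move: bp bp' => /= /andP[-> bp] bp'; rewrite all_cat bp.
Qed.

(** The bad sites of the contour of the origin described by the numbers [a] of
moves [diag] before each bad site and [b] of reversed moves [up] after each of
them; the last entry of [b], which [zip] drops, only brings the walk back to the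
origin. *)
Definition contour (a b : seq nat) : seq site :=
  let s := ((head 0%N a)%:Z, head 0%N a) in
  s :: scanl jump s (zip (behead a) b).

Lemma path_contour s p : path linked s p ->
  exists t : seq (nat * nat), [/\ p = scanl jump s t,
    (last s p).1 = s.1 + (\sum_(ab <- t) ab.1)%N%:Z - (size t)%:Z &
    (last s p).2%:Z = s.2%:Z + (\sum_(ab <- t) ab.1)%N%:Z - (\sum_(ab <- t) ab.2)%N%:Z].
Proof.
elim: p s => [|u p IH] s /= => [_|/andP[/linkedP[ab uE h] /IH[t [pE h1 h2]]]].
  by exists [::]; split => //=; rewrite !big_nil; lia.
exists (ab :: t); split => /=; rewrite ?big_cons -?uE -?pE// ?h1 ?h2 uE /jump /=; lia.
Qed.

(** After loop erasure the bad sites are distinct. Both sums equal the number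
[m] of unit moves to the left because the walk is closed, and this is what bounds
the number of contours. *)
Lemma doomed_origin bad n : doomed bad n (0, 0%N) ->
  exists m a b, [/\ size a = m.+1, size b = m.+1, sumn a = m, sumn b = m &
    uniq (contour a b) && all bad (contour a b)].
Proof.
move=> /doomed_contour[s [p [[a /= sE] sp [b lE] bp]]].
move: lE; case/shortenP: sp => p' sp' up' sub lE.
have [t [pE h1 h2]] := path_contour sp'.
have st : size (unzip1 t) = size (unzip2 t) by rewrite !size_map.
have cE : contour (a :: unzip1 t) (rcons (unzip2 t) b) = s :: p'.
  have sE' : s = (a%:Z, a) by rewrite sE; congr pair; lia.
  by rewrite /contour /= -cats1 -[unzip1 t]cats0 zip_cat//= zip_unzip cats0 -sE' pE.
exists (size t), (a :: unzip1 t), (rcons (unzip2 t) b).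
have S1 : sumn (unzip1 t) = (\sum_(ab <- t) ab.1)%N by rewrite sumnE big_map.
have S2 : sumn (unzip2 t) = (\sum_(ab <- t) ab.2)%N by rewrite sumnE big_map.
move: h1 h2; rewrite lE sE -S1 -S2 /= => h1 h2.
have U : uniq (contour (a :: unzip1 t) (rcons (unzip2 t) b)) &&
    all bad (contour (a :: unzip1 t) (rcons (unzip2 t) b)).
  rewrite cE up'; apply/allP => x; rewrite inE => /predU1P[->|/sub xp].
    by case/andP: bp.
  by case/andP: bp => _ /allP; apply.
split=> //; rewrite ?size_rcons /= ?size_map ?sumn_rcons//; lia.
Qed.

(** * Open paths between the columns of good sites *)

Definition ostep (w : config) : rel vertex := fun u u' =>
  (u'.2 == u.2.+1) && w (u.1, u.2, u'.1 - u.1).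

Definition reach (w : config) (u u' : vertex) : Prop :=
  exists2 p, path (ostep w) u p & last u p = u'.

Lemma reach_refl w u : reach w u u.
Proof. by exists [::]. Qed.

Lemma reach_trans w u1 u2 u3 : reach w u1 u2 -> reach w u2 u3 -> reach w u1 u3.
Proof.
move=> [p pp lp] [q qq lq]; exists (p ++ q); first by rewrite cat_path pp lp.
by rewrite last_cat lp.
Qed.

Lemma reach_step w u u' : reach w u u' -> u != u' ->
  exists2 u1, ostep w u u1 & reach w u1 u'.
Proof.
move=> [[|u1 p] /= + <-]; first by rewrite eqxx.
by case/andP => su pp _; exists u1 => //; exists p.
Qed.

(** A set of vertices from which one can always step inside the set carries an
infinite path, by dependent choice. *)
Lemma percolatesW w (S : vertex -> Prop) : S (0, 0%N) ->
  (forall u, S u -> exists2 u', S u' & ostep w u u') -> percolates w.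
Proof.
move=> S0 Snext.
have next (x : {u | S u}) : {y : {u | S u} | ostep w (sval x) (sval y)}.
  apply: cid; have [u' Su' su'] := Snext _ (svalP x).
  by exists (exist _ u' Su').
pose f := fun n => iter n (fun x => sval (next x)) (exist _ _ S0).
exists (fun n => sval (f n)); split=> // i.
have := svalP (next (f i)); rewrite -/(f i.+1).
case: (sval (f i)) (sval (f i.+1)) => [x m] [x' m'] /andP[/= /eqP -> wo].
exists (x, m, x' - x); split => //; rewrite /bond_tgt /=; congr pair; lia.
Qed.

Section gadgets.
Variables (a T K : nat).

(** A gadget [((y, s), j, d)] is a pair of successive bonds used by the site
[(y, s)] at its double step [j]; [d] is the displacement of the first bond. If
[d = a], both bonds have displacement [a] and lead from the column of [y] to that
of [y + 1]. If [d > a], it is a loop at the column of [y], and if [d < - a], a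
loop at the column of [y + 1]. *)
Definition gadget : Type := (site * nat * int)%type.

Definition column (y : int) : int := y * a.*2%:Z.

Definition gcolumn (g : gadget) : int :=
  column (if 0 < g.2 then g.1.1.1 else g.1.1.1 + 1).

Definition gtime (g : gadget) : nat := (T * g.1.1.2 + g.1.2).*2.

Definition gbond (g : gadget) (second : bool) : bond :=
  if second then
    (gcolumn g + g.2, (gtime g).+1, if g.2 == a then g.2 else - g.2)
  else (gcolumn g, gtime g, g.2).

Definition gopen (w : config) (g : gadget) : bool :=
  w (gbond g false) && w (gbond g true).

Definition valid (g : gadget) : bool :=
  [&& (g.1.2 < T)%N, (a <= `|g.2|)%N & g.2 != - a%:Z].

Definition loop_lengths : seq nat := iota a.+1 (K - a).

(** The site [v] is bad when all the gadgets of one of these lists fail: the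
loops of one double step in one of the two columns, or all the displacements
from one column to the other. *)
Definition cuts (v : site) : seq (seq gadget) :=
  [seq [seq (v, j, n%:Z) | n <- loop_lengths] | j <- iota 0 T] ++
  [seq [seq (v, j, - n%:Z) | n <- loop_lengths] | j <- iota 0 T] ++
  [:: [seq (v, j, a%:Z) | j <- iota 0 T]].

Definition bad (w : config) (v : site) : bool :=
  has (all (fun g => ~~ gopen w g)) (cuts v).

Definition base (v : site) : vertex := (column v.1, (T * v.2).*2).

Lemma gopen_reach w g : gopen w g ->
  reach w (gcolumn g, gtime g)
    (gcolumn g + (if g.2 == a then g.2 + g.2 else 0), (gtime g).+2).
Proof.
move=> /andP[/= w1 w2].
exists [:: (gcolumn g + g.2, (gtime g).+1);
   (gcolumn g + (if g.2 == a then g.2 + g.2 else 0), (gtime g).+2)] => //=.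
rewrite /ostep /= !eqxx andbT /= addrAC subrr add0r w1 /=.
rewrite (_ : _ - _ = if g.2 == a then g.2 else - g.2) //.
by case: eqP; lia.
Qed.

Hypothesis a0 : (0 < a)%N.

Lemma good_cut w v c : ~~ bad w v -> c \in cuts v -> exists2 g, g \in c & gopen w g.
Proof.
move=> /hasPn + cv; move=> /(_ _ cv) /allPn[g gc]; rewrite negbK => og.
by exists g.
Qed.

Lemma good_loop w v j (b : bool) : ~~ bad w v -> (j < T)%N ->
  let x := column (if b then v.1 else v.1 + 1) in
  reach w (x, (T * v.2 + j).*2) (x, (T * v.2 + j.+1).*2).
Proof.
move=> gv jT x.
have jj : j \in iota 0 T by rewrite mem_iota.
suff [n na /gopen_reach] : exists2 n : nat, (a < n)%N &
    gopen w (v, j, if b then n%:Z else - n%:Z).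
  rewrite /gcolumn /gtime /= => H.
  have E1 : (if 0 < (if b then n%:Z else - n%:Z) then v.1 else v.1 + 1) =
      (if b then v.1 else v.1 + 1).
    by case: (b); case: ifP => //; lia.
  have E2 : ((if b then n%:Z else - n%:Z) == a) = false by case: (b); lia.
  by move: H; rewrite E1 E2 addr0 addnS doubleS.
case: b {x}.
- have /(good_cut gv) : [seq (v, j, n%:Z) | n <- loop_lengths] \in cuts v.
    by rewrite mem_cat; apply/orP; left; apply/mapP; exists j.
  case=> g /mapP[n]; rewrite mem_iota => /andP[an _] -> og.
  by exists n.
- have /(good_cut gv) : [seq (v, j, - n%:Z) | n <- loop_lengths] \in cuts v.
    by rewrite !mem_cat; apply/orP; right; apply/orP; left; apply/mapP; exists j.
  case=> g /mapP[n]; rewrite mem_iota => /andP[an _] -> og.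
  by exists n.
Qed.

Lemma good_stay w v i j (b : bool) : ~~ bad w v -> (i <= j <= T)%N ->
  let x := column (if b then v.1 else v.1 + 1) in
  reach w (x, (T * v.2 + i).*2) (x, (T * v.2 + j).*2).
Proof.
move=> gv + x; elim: j => [|j IH] ij.
  have -> : i = 0%N by lia.
  exact: reach_refl.
have [->|ij'] := eqVneq i j.+1; first exact: reach_refl.
apply: reach_trans (IH _) _; first lia.
by apply: good_loop; lia.
Qed.

Lemma good_up w v : ~~ bad w v -> reach w (base v) (base (up v)).
Proof.
move=> /(good_stay (i := 0) (j := T) true) /=.
by rewrite addn0 leqnn /base /= mulnS addnC; apply.
Qed.

(** Wait in the first column for the open displacement, and after it in the
second column. *)
Lemma good_diag w v : ~~ bad w v -> reach w (base v) (base (diag v)).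
Proof.
move=> gv.
have /(good_cut gv) : [seq (v, j, a%:Z) | j <- iota 0 T] \in cuts v.
  by rewrite !mem_cat inE eqxx !orbT.
case=> g /mapP[j]; rewrite mem_iota => /andP[_ jT] -> /gopen_reach.
rewrite /gcolumn /gtime /= eqxx ltz_nat a0 => H.
have := good_stay (i := 0) (j := j) true gv; rewrite /= addn0 => H0.
apply: reach_trans (H0 _) _; first by lia.
apply: reach_trans H _.
have := good_stay (i := j.+1) (j := T) false gv; rewrite /= => H1.
have -> : column v.1 + (a%:Z + a%:Z) = column (v.1 + 1).
  by rewrite /column mulrDl mul1r -addnn PoszD.
by rewrite /base /= mulnS [(T + _)%N]addnC -doubleS -addnS; apply: H1; lia.
Qed.

(** This is a form of Koenig's lemma: an undoomed site has an undoomed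
successor. The time of [base] increases strictly, hence a vertex that leads to the
base of an undoomed site can always step to another such vertex. *)
Lemma undoomed_percolates w : (0 < T)%N ->
  (forall n, ~~ doomed (bad w) n (0, 0%N)) -> percolates w.
Proof.
move=> T0 al0.
pose alive v := forall n, ~~ doomed (bad w) n v.
have aliveS v : alive v -> ~~ bad w v /\ (alive (up v) \/ alive (diag v)).
  move=> av; split; first by have := av 1%N; rewrite /= orbF.
  apply: contrapT => /not_orP[/existsNP[n /negP]]; rewrite negbK => nu.
  move=> /existsNP[m /negP]; rewrite negbK => md.
  have /negP := av (maxn n m).+1; apply => /=.
  by rewrite (leq_doomed (leq_maxl n m) nu) (leq_doomed (leq_maxr n m) md) orbT.
apply: (@percolatesW w (fun u => exists2 v, alive v & reach w u (base v))).
  exists (0, 0%N) => //; rewrite /base /column /= mul0r muln0; exact: reach_refl.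
have step u v : alive v -> reach w u (base v) -> u != base v ->
    exists2 u', (exists2 v, alive v & reach w u' (base v)) & ostep w u u'.
  by move=> av /reach_step /[apply] -[u' su ru]; exists u' => //; exists v.
move=> u [v av ruv]; have [uE|] := eqVneq u (base v); last exact: step ruv.
have [gv [av'|av']] := aliveS _ av.
- apply: step av' _ _; rewrite uE; first exact: good_up.
  by apply/eqP; case; lia.
- apply: step av' _ _; rewrite uE; first exact: good_diag.
  by apply/eqP => /(congr1 snd) /=; nia.
Qed.

(** All the bonds of all the gadgets are distinct. The parity of the time tells
the first bond of a gadget from the second one, and the displacement of a bond
tells its column: a length [a] belongs to a sideways move, and the sign of a
larger one to a loop of the left or of the right column. *)
Lemma gbond_inj g g' b b' : valid g -> valid g' -> gbond g b = gbond g' b' ->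
  (g, b) = (g', b').
Proof.
move: g g' => [[[y s] j] d] [[[y' s'] j'] d'] /and3P[/= jT ad da] /and3P[/= jT' ad' da'].
have dvd y1 y2 : column y1 = column y2 -> y1 = y2.
  by move=> /mulIf; apply; lia.
have tm : (T * s + j = T * s' + j')%N -> s = s' /\ j = j'.
  move=> E; have T0 : (0 < T)%N by lia.
  have Es : s = s'.
    have := congr1 (divn^~ T) E; rewrite /= ![(T * _)%N]mulnC !divnMDl//.
    by rewrite !divn_small// !addn0.
  by split=> //; move: E; rewrite Es; lia.
rewrite /gbond; case: b; case: b' => /= -[]; rewrite /gcolumn /gtime /=; try lia.
- move=> Ex Et Ed; have [|-> ->] := tm; first lia.
  have dE : d = d' by move: Ed; case: eqP; case: eqP; lia.
  subst d'; congr (_, _, _, _, _); move: Ex => /addIr /dvd; case: ifP; lia.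
- move=> Ex Et Ed; have [|-> ->] := tm; first lia.
  subst d'; congr (_, _, _, _, _); move: Ex => /dvd; case: ifP; lia.
Qed.

Lemma valid_cuts v c : c \in cuts v ->
  [/\ uniq c, all valid c & all (fun g => g.1.1 == v) c].
Proof.
rewrite /cuts !mem_cat inE => /or3P[/mapP[j]|/mapP[j]|/eqP ->];
  rewrite ?mem_iota; [move=> /andP[_ jT] ->|move=> /andP[_ jT] ->|];
  rewrite map_inj_uniq ?iota_uniq ?all_map; (try by move=> ? ? []; lia);
  split => //; apply/allP => n; rewrite mem_iota /valid /= ?eqxx//;
  move=> ?; apply/and3P; split; lia.
Qed.

End gadgets.

(** * Counting contours *)

(** The compositions of [m] into [m + 1] parts, possibly zero, through the
ordinal tuples that [card_ord_partitions] counts. *)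
Definition comps (m : nat) : seq (seq nat) :=
  [seq map val (val t) | t <- enum
    [set t : m.+1.-tuple 'I_m.+1 | \sum_(i <- t) i == m]%N%SET].

Lemma mem_comps m s : size s = m.+1 -> sumn s = m -> s \in comps m.
Proof.
move=> ss sm; have sle i : (nth 0 s i <= m)%N.
  have [si|si] := ltnP i (size s); last by rewrite nth_default.
  rewrite -sm sumnE (big_nth 0%N) big_mkord (bigD1 (Ordinal si)) //=.
  exact: leq_addr.
pose t := [tuple (inord (nth 0%N s i) : 'I_m.+1) | i < m.+1].
have tE : map val (val t) = s.
  apply: (@eq_from_nth _ 0%N); rewrite size_map size_tuple ?ss// => i im.
  rewrite (nth_map ord0) ?size_tuple// -[i]/(val (Ordinal im)).
  by rewrite -tnth_nth tnth_mktuple /= inordK ?ltnS.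
apply/mapP; exists t => //; rewrite mem_enum inE; apply/eqP.
by apply: etrans (etrans (congr1 sumn tE) sm); rewrite sumnE big_map.
Qed.

Lemma leq_bin_exp n m : ('C(n, m) <= 2 ^ n)%N.
Proof.
elim: n m => [|n IH] [|m]; rewrite ?bin0 ?expn_gt0// ?bin0n//.
by rewrite binS expnS mul2n -addnn leq_add.
Qed.

Lemma size_comps m : (size (comps m) <= 4 ^ m)%N.
Proof.
rewrite size_map -cardE card_ord_partitions.
by rewrite (leq_trans (leq_bin_exp _ _)) // addnn -mul2n expnM.
Qed.

Lemma size_contour m a b : size a = m.+1 -> size b = m.+1 -> size (contour a b) = m.+1.
Proof.
by move=> sa sb; rewrite /contour /= size_scanl size_zip size_behead sa sb /=; lia.
Qed.

(** * The Peierls estimate *)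

Section percolation.
Variables (R : realType) (q : nat -> R) (P : probability config R).
Hypothesis q01 : forall n, 0 <= q n <= 1.
Hypothesis hP : is_bond_percolation q P.

Definition meas (f : config -> bool) := measurable [set w | f w].

Lemma meas_bond (e : bond) : meas (fun w => w e).
Proof. by apply: sub_sigma_algebra; exists e. Qed.

Lemma meas_neg f : meas f -> meas (fun w => ~~ f w).
Proof.
move=> mf; rewrite /meas.
have -> : [set w | ~~ f w] = ~` [set w | f w].
  by apply/seteqP; split=> w /= /negP.
exact: measurableC.
Qed.

Lemma meas_and f g : meas f -> meas g -> meas (fun w => f w && g w).
Proof.
move=> mf mg; rewrite /meas.
have -> : [set w | f w && g w] = [set w | f w] `&` [set w | g w].
  by apply/seteqP; split=> w /= /andP.
exact: measurableI.
Qed.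

Lemma meas_all (I : Type) (s : seq I) (f : I -> config -> bool) :
  (forall i, meas (f i)) -> meas (fun w => all (f^~ w) s).
Proof.
move=> mf; elim: s => [|i s IH] /=; last exact: meas_and.
rewrite /meas (_ : [set w | true] = setT) //; by apply/seteqP; split.
Qed.

Lemma meas_has (I : Type) (s : seq I) (f : I -> config -> bool) :
  (forall i, meas (f i)) -> meas (fun w => has (f^~ w) s).
Proof.
move=> mf; rewrite (_ : (fun w => _) = fun w => ~~ all (fun i => ~~ f i w) s).
  by apply: meas_neg; apply: meas_all => i; exact: meas_neg.
by apply/funext => w; rewrite -has_predC; apply: eq_has => i /=; rewrite negbK.
Qed.

Lemma prob_has (I : Type) (s : seq I) (f : I -> config -> bool) :
  (forall i, meas (f i)) ->
  (P [set w : config | has (f^~ w) s] <= \sum_(i <- s) P [set w : config | f i w])%E.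
Proof.
move=> mf; elim: s => [|i s IH] /=.
  rewrite big_nil (_ : [set w | false] = set0) ?measure0//.
  by apply/seteqP; split.
rewrite big_cons (_ : [set w | _] = [set w | f i w] `|` [set w | has (f^~ w) s]).
  apply: (le_trans (measureU2 _ _ _)); [exact: mf|exact: meas_has|].
  by rewrite leeD2l.
by apply/seteqP; split=> w /= /orP.
Qed.

Lemma meas_open_blocked (s : seq bond) (L : seq (bond * bond)) :
  meas (fun w => all w s && all (fun e => ~~ (w e.1 && w e.2)) L).
Proof.
apply: meas_and; first exact: meas_all meas_bond.
apply: (@meas_all _ L (fun e w => ~~ (w e.1 && w e.2))) => e.
by apply: meas_neg; apply: meas_and; exact: meas_bond.
Qed.

(** Disjoint pairs of bonds fail independently. The open bonds [s] are there for
the induction: a pair fails unless both of its bonds are open, and subtracting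
the case where they are puts them into [s]. *)
Lemma prob_blocked (s : seq bond) (L : seq (bond * bond)) :
  uniq (s ++ flatten [seq [:: e.1; e.2] | e <- L]) ->
  P [set w : config | all w s && all (fun e => ~~ (w e.1 && w e.2)) L] =
  (\prod_(e <- s) q (bond_len e) *
   \prod_(e <- L) (1 - q (bond_len e.1) * q (bond_len e.2)))%:E.
Proof.
elim: L s => [|[e1 e2] L IH] s /= us.
  rewrite big_nil mulr1; have := @hP s (fun=> true).
  rewrite cats0 in us => /(_ us) <-; congr (P _).
  apply/seteqP; split => w /=; first by rewrite andbT => /allP.
  by move=> H; rewrite andbT; apply/allP.
have us2 : uniq ([:: e1, e2 & s] ++ flatten [seq [:: e.1; e.2] | e <- L]).
  move: us; rewrite -[[:: e1, e2 & flatten _]]/([:: e1; e2] ++ flatten _).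
  by rewrite (perm_uniq (permEl (perm_catCA _ _ _))).
have us1 : uniq (s ++ flatten [seq [:: e.1; e.2] | e <- L]).
  by move: us2; rewrite /= => /and3P[].
have mA := meas_open_blocked s L.
have mB := meas_open_blocked [:: e1, e2 & s] L.
have -> : [set w : config | all w s && (~~ (w e1 && w e2) &&
      all (fun e => ~~ (w e.1 && w e.2)) L)] =
    [set w : config | all w s && all (fun e => ~~ (w e.1 && w e.2)) L] `\`
    [set w : config | all w [:: e1, e2 & s] && all (fun e => ~~ (w e.1 && w e.2)) L].
  apply/seteqP; split=> w /=; case: (w e1); case: (w e2); case: (all w s);
    by case: (all _ L) => //= -[].
have -> (A B : set config) : measurable A -> measurable B -> B `<=` A ->
    P (A `\` B) = (P A - P B)%E.
  move=> mA' mB' BA; rewrite measureD ?(setIidr BA)//.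
  by rewrite (le_lt_trans (probability_le1 _ mA')) ?ltry.
- rewrite (IH _ us1) (IH _ us2) -EFinD !big_cons /=; congr EFin; ring.
- by [].
- by [].
- by move=> w /= /andP[/and3P[_ _ ->] ->].
Qed.

Section gadgets.
Variables (a T K : nat).
Hypothesis a0 : (0 < a)%N.

Let gb := gbond a T.
Let blocked (L : seq gadget) (w : config) := all (fun g => ~~ gopen a T w g) L.

Lemma uniq_gadget_bonds (L : seq gadget) : uniq L -> all (valid a T) L ->
  uniq (flatten [seq [:: gb g false; gb g true] | g <- L]).
Proof.
move=> uL /allP vL.
rewrite (_ : flatten _ = [seq gb g b | g <- L, b <- [:: false; true]]) //.
apply: allpairs_uniq => // -[g b] [g' b'].
move=> /allpairsP[[h c] [hL _ [-> ->]]] /allpairsP[[h' c'] [hL' _ [-> ->]]].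
exact: gbond_inj (vL _ _) (vL _ _).
Qed.

Lemma meas_blocked L : meas (blocked L).
Proof.
apply: (@meas_all _ _ (fun g w => ~~ gopen a T w g)) => g.
by apply: meas_neg; apply: meas_and; exact: meas_bond.
Qed.

Lemma prob_blocked_gadgets (L : seq gadget) : uniq L -> all (valid a T) L ->
  P [set w : config | blocked L w] = (\prod_(g <- L) (1 - q `|g.2|%N ^+ 2))%:E.
Proof.
move=> uL vL.
have := @prob_blocked [::] [seq (gb g false, gb g true) | g <- L].
rewrite -map_comp => /(_ (uniq_gadget_bonds uL vL)) H.
rewrite (_ : [set w | blocked L w] = [set w : config | all w [::] &&
  all (fun e => ~~ (w e.1 && w e.2)) [seq (gb g false, gb g true) | g <- L]]).
  rewrite H big_nil mul1r big_map; congr EFin; apply: eq_bigr => g _ /=.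
  by rewrite /bond_len /= expr2; case: ifP => //; rewrite abszN.
by apply/seteqP; split=> w /=; rewrite all_map.
Qed.

(** The sum over the cuts of a site of the probability that all the gadgets of
the cut fail. *)
Definition cut_prob : R :=
  T%:R * (\prod_(n <- loop_lengths a K) (1 - q n ^+ 2)) *+ 2 + (1 - q a ^+ 2) ^+ T.

Lemma sum_cuts v : \sum_(c <- cuts a T K v) \prod_(g <- c) (1 - q `|g.2|%N ^+ 2) = cut_prob.
Proof.
rewrite /cuts !big_cat /= big_seq1 !big_map /cut_prob mulr2n addrA.
have -> : iota 0 T = index_iota 0 T by rewrite /index_iota subn0.
congr (_ + _ + _).
- transitivity (\sum_(0 <= j < T) \prod_(n <- loop_lengths a K) (1 - q n ^+ 2)).
    by apply: eq_bigr => j _; rewrite big_map.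
  by rewrite sumr_const_nat subn0 mulr_natl.
- transitivity (\sum_(0 <= j < T) \prod_(n <- loop_lengths a K) (1 - q n ^+ 2)).
    apply: eq_bigr => j _; rewrite big_map; apply: eq_bigr => n _ /=.
    by rewrite abszN.
  by rewrite sumr_const_nat subn0 mulr_natl.
- by rewrite /= prodr_const_nat subn0.
Qed.

Let r01 n : 0 <= 1 - q n ^+ 2 <= 1.
Proof. have := q01 n; nra. Qed.

Let prod_ge0 (L : seq gadget) : 0 <= \prod_(g <- L) (1 - q `|g.2|%N ^+ 2).
Proof. by apply: prodr_ge0 => g _; have /andP[] := r01 `|g.2|%N. Qed.

Lemma cut_prob_ge0 : 0 <= cut_prob.
Proof. by rewrite -(sum_cuts (0, 0%N)); apply: sumr_ge0 => c _. Qed.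

Lemma meas_bad v : meas ((bad a T K)^~ v).
Proof.
apply: (@meas_has _ _ (fun c w => blocked c w)) => c; exact: meas_blocked.
Qed.

(** A bad site has a cut that fails; the union bound over the cuts of the first
site moves it from the list of sites to the list of failing gadgets, all of which
are handled at once by independence when the sites are exhausted. *)
Lemma prob_bad_blocked (l : seq site) (L : seq gadget) :
  uniq l -> uniq L -> all (valid a T) L -> all (fun g => g.1.1 \notin l) L ->
  (P [set w : config | all (bad a T K w) l && blocked L w] <=
   (cut_prob ^+ size l * \prod_(g <- L) (1 - q `|g.2|%N ^+ 2))%:E)%E.
Proof.
elim: l L => [|v l IH] L /=.
  by move=> _ uL vL _; rewrite expr0 mul1r prob_blocked_gadgets.
move=> /andP[vl ul] uL vL Ll.
rewrite (_ : [set w | _] = [set w | has (fun c =>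
    all (bad a T K w) l && blocked (c ++ L) w) (cuts a T K v)]); last first.
  apply/seteqP; split=> w /=.
    case/andP=> /andP[/hasP[c cv bc] bl] bL; apply/hasP; exists c => //.
    by rewrite bl /blocked all_cat bc.
  case/hasP=> c cv /andP[bl]; rewrite /blocked all_cat => /andP[bc bL].
  by rewrite bl bL !andbT; apply/hasP; exists c.
apply: (le_trans (@prob_has _ _ (fun c w => all (bad a T K w) l && blocked (c ++ L) w) _)).
  move=> c; apply: meas_and; last exact: meas_blocked.
  by apply: (@meas_all _ _ (fun v w => bad a T K w v)) => u; exact: meas_bad.
rewrite exprS -{1}(sum_cuts v) mulr_suml mulr_suml -sumEFin.
rewrite [X in (X <= _)%E]big_seq [X in (_ <= X)%E]big_seq.
apply: lee_sum => c cv; have [uc vc /allP cE] := valid_cuts a0 cv.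
apply: le_trans (IH _ ul _ _ _) _.
- rewrite cat_uniq uc uL andbT /=; apply/hasPn => g gL.
  apply/negP => /cE /eqP gv.
  by move/allP: Ll => /(_ _ gL); rewrite gv inE eqxx.
- by rewrite all_cat vc.
- rewrite all_cat; apply/andP; split; apply/allP => g.
    by move=> /cE /eqP ->.
  by move=> gL; move/allP: Ll => /(_ _ gL); rewrite inE negb_or => /andP[].
- by rewrite big_cat /= lee_fin le_eqVlt; apply/orP; left; apply/eqP; ring.
Qed.

Lemma prob_bad (l : seq site) : uniq l ->
  (P [set w : config | all (bad a T K w) l] <= (cut_prob ^+ size l)%:E)%E.
Proof.
move=> ul; have := @prob_bad_blocked l [::] ul isT isT isT.
rewrite big_nil mulr1; congr (P _ <= _)%E; apply/seteqP.
by split=> w /=; rewrite andbT.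
Qed.

Definition bad_along (m : nat) (ab : seq nat * seq nat) (w : config) : bool :=
  let s := contour ab.1 ab.2 in [&& size s == m.+1, uniq s & all (bad a T K w) s].

Definition bad_contour (m : nat) (w : config) : bool :=
  has (bad_along m ^~ w) [seq (a, b) | a <- comps m, b <- comps m].

Let meas_bad_along m ab : meas (bad_along m ab).
Proof.
have guard (b : bool) f : meas f -> meas (fun w => b && f w).
  case: b => // _; rewrite /meas (_ : [set w | _] = set0) //.
  by apply/seteqP; split.
do 2 apply: (guard).
by apply: (@meas_all _ _ (fun v w => bad a T K w v)) => u; exact: meas_bad.
Qed.

Lemma meas_bad_contour m : meas (bad_contour m).
Proof. exact: (meas_has _ (meas_bad_along m)). Qed.

Lemma prob_bad_contour m :
  (P [set w : config | bad_contour m w] <= (16 ^+ m * cut_prob ^+ m.+1)%:E)%E.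
Proof.
apply: le_trans (prob_has _ (meas_bad_along m)) _.
have c0 := cut_prob_ge0.
apply: (@le_trans _ _ (\sum_(ab <- [seq (a, b) | a <- comps m, b <- comps m])
    (cut_prob ^+ m.+1)%:E)%E).
  apply: lee_sum => ab _; rewrite /bad_along; set s := contour _ _.
  have [/andP[/eqP sm us]|F] := boolP ((size s == m.+1) && uniq s).
    rewrite -sm; apply: le_trans (prob_bad us).
    by rewrite sm eqxx us.
  rewrite (_ : [set w | _] = set0) ?measure0 ?lee_fin ?exprn_ge0//.
  by apply/seteqP; split=> w //=; rewrite andbA (negbTE F).
rewrite sumEFin big_const_seq count_predT iter_addr_0 lee_fin size_allpairs.
rewrite -[X in X <= _]mulr_natl ler_wpM2r ?exprn_ge0//.
rewrite -natrX ler_nat (_ : 16 = 4 * 4)%N// expnMn.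
exact: leq_mul (size_comps m) (size_comps m).
Qed.

Lemma contour_percolates w : (0 < T)%N -> (forall m, ~~ bad_contour m w) ->
  percolates w.
Proof.
move=> T0 nb; apply: (@undoomed_percolates a T K a0 w T0) => n; apply/negP.
move=> /doomed_origin[m [s [t [ss st sms smt /andP[us bs]]]]].
have /negP := nb m; apply; apply/hasP; exists (s, t).
  by apply/allpairsP; exists (s, t); rewrite !mem_comps.
change [&& size (contour s t) == m.+1, uniq (contour s t) &
  all (bad a T K w) (contour s t)].
by rewrite (size_contour ss st) eqxx us bs.
Qed.

(** Percolation contains the measurable event that there is no bad contour, and
the completed probability is an outer measure, so that it is monotone on all
sets. The bound on [cut_prob] makes the terms of the Peierls series halve. *)
Lemma completed_prob_ge : (0 < T)%N -> cut_prob <= 32^-1 ->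
  ((1 - 2 * cut_prob)%:E <= completed_prob P percolates)%E.
Proof.
move=> T0 c32; have c0 := cut_prob_ge0.
pose F m := [set w | bad_contour m w].
have mF m : measurable (F m) by exact: meas_bad_contour.
have mU : measurable (\bigcup_m F m) by exact: bigcupT_measurable.
have PU : (P (\bigcup_m F m) <= (2 * cut_prob)%:E)%E.
  apply: le_trans (measure_sigma_subadditive P mF mU (@subset_refl _ _)) _.
  apply: le_trans _ (epsilon_trick0 xpredT (_ : 0 <= 2 * cut_prob)); last by lra.
  apply: lee_nneseries => [i _ _|i _]; first exact: measure_ge0.
  apply: le_trans (prob_bad_contour i) _; rewrite lee_fin.
  have -> : 2 * cut_prob / (2 ^ i.+1)%:R = cut_prob * 2^-1 ^+ i.
    rewrite expnS natrM natrX exprVn invfM; field.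
    by rewrite expf_neq0// pnatr_eq0.
  rewrite exprS mulrCA -exprMn ler_wpM2l// lerXn2r ?nnegrE//; lra.
have sub : ~` (\bigcup_m F m) `<=` percolates.
  by move=> w nF; apply: contour_percolates => // m; apply/negP => bm; apply: nF; exists m.
apply: (@le_trans _ _ (P (~` (\bigcup_m F m)))).
  by rewrite probability_setC// EFinB leeB.
rewrite -(measurable_mu_extE P (measurableC mU)); exact: le_mu_ext.
Qed.

End gadgets.

Lemma completed_prob_le1 A : (completed_prob P A <= 1)%E.
Proof.
rewrite -(@probability_setT _ _ _ P) -(measurable_mu_extE P measurableT).
exact: le_mu_ext.
Qed.

End percolation.

(** * Choice of the parameters *)

Section choice.
Variables (R : realType) (p : nat -> R).
Hypothesis p01 : forall n, 0 <= p n <= 1.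
Hypothesis p2_diverges : (\sum_(0 <= n <oo) (p n ^+ 2)%:E = +oo)%E.

Lemma partial_sums_unbounded (M : R) :
  exists N, M < \sum_(0 <= n < N) p n ^+ 2.
Proof.
apply: contrapT => /forallNP H.
suff : (\sum_(0 <= n <oo) (p n ^+ 2)%:E <= M%:E)%E by rewrite p2_diverges leNgt ltry.
apply: lime_le.
  by apply: is_cvg_nneseries => n _ _; rewrite lee_fin sqr_ge0.
apply: nearW => N; rewrite sumEFin lee_fin leNgt; exact/negP.
Qed.

Lemma exists_positive : exists2 a, (0 < a)%N & 0 < p a.
Proof.
have [N] := partial_sums_unbounded 1; apply: contraPP => /forall2NP H.
have H0 n : (0 < n)%N -> p n = 0.
  move=> n0; have [//|/negP] := H n; have /andP[+ _] := p01 n.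
  by rewrite -leNgt => ? ?; apply/eqP; rewrite eq_le; apply/andP.
apply/negP; rewrite -leNgt; have := p01 0%N.
case: N => [|N]; first by rewrite big_nil ler01.
rewrite big_nat_recl// big1 => [|n _]; last by rewrite H0// expr0n.
by rewrite addr0 => ?; nra.
Qed.

(** Each factor is at most [expR (- p n ^+ 2)]. *)
Lemma prod_loops_small (a : nat) (eta : R) : 0 < eta ->
  exists K0, forall K, (K0 <= K)%N -> \prod_(n <- loop_lengths a K) (1 - p n ^+ 2) <= eta.
Proof.
move=> eta0.
have [N HN] := partial_sums_unbounded (\sum_(0 <= n < a.+1) p n ^+ 2 + eta^-1).
exists (maxn N a) => K; rewrite geq_max => /andP[NK aK].
have -> : loop_lengths a K = index_iota a.+1 K.+1 by rewrite /loop_lengths /index_iota subSS.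
set S := \sum_(a.+1 <= n < K.+1) p n ^+ 2.
have HS : eta^-1 <= S.
  have : \sum_(0 <= n < N) p n ^+ 2 <= \sum_(0 <= n < K.+1) p n ^+ 2.
    rewrite (big_cat_nat (n := N) (p := K.+1))//=; last exact: leqW.
    by rewrite lerDl sumr_ge0// => n _; exact: sqr_ge0.
  rewrite (big_cat_nat (n := a.+1) (p := K.+1))//= -/S; lra.
apply: (@le_trans _ _ (expR (- S))).
  rewrite -sumrN expR_sum; apply: ler_prod => n _.
  by rewrite expR_ge1Dx andbT; have := p01 n; nra.
rewrite expRN -[leRHS]invrK lef_pV2 ?posrE ?expR_gt0 ?invr_gt0//.
by apply: le_trans (expR_ge1Dx S); lra.
Qed.

(** First [T] is chosen so large that a sideways move succeeds, then the
truncation level so large, depending on [T], that all [2 T] waits succeed. *)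
Lemma cut_prob_small (a : nat) (eta : R) : 0 < p a -> 0 < eta ->
  exists2 T, (0 < T)%N & exists K0, forall K, (K0 <= K)%N ->
    cut_prob (truncation p K) a T K <= eta.
Proof.
move=> pa eta0.
have [T T0 HT] : exists2 T, (0 < T)%N & (1 - p a ^+ 2) ^+ T <= eta / 2.
  have r1 : `|1 - p a ^+ 2| < 1.
    by have := p01 a; rewrite ltr_norml => ?; apply/andP; split; nra.
  have /cvgrPdist_le /(_ (eta / 2)) := cvg_expr r1.
  case=> [|N _ HN]; first by lra.
  exists N.+1 => //; have := HN N.+1 (leqnSn N).
  by rewrite /= sub0r normrN; apply: le_trans; exact: ler_norm.
exists T => //.
have T0' : 0 < T%:R :> R by rewrite ltr0n.
have [|K0 HK] := @prod_loops_small a (eta / 4 / T%:R); first by rewrite !divr_gt0.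
exists (maxn K0 a) => K; rewrite geq_max => /andP[K0K aK].
rewrite /cut_prob {2}/truncation aK.
rewrite (eq_big_seq (fun n => 1 - p n ^+ 2)); last first.
  by move=> n; rewrite mem_iota /truncation => ?; rewrite ifT//; lia.
have := HK _ K0K; rewrite ler_pdivlMr// mulrC => HK'; lra.
Qed.

End choice.

Theorem theorem3 (R : realType) (p : nat -> R)
    (p01 : forall n, 0 <= p n <= 1)
    (p2_diverges : (\sum_(0 <= n <oo) (p n ^+ 2)%:E = +oo)%E)
    (PK : nat -> probability config R)
    (PK_percolation : forall K : nat, (0 < K)%N ->
       is_bond_percolation (truncation p K) (PK K)) :
  (exists K : nat, (0 < K)%N /\ (0 < completed_prob (PK K) percolates)%E) /\
  (fun K : nat => completed_prob (PK K) percolates) @ \oo --> (1 : \bar R)%E.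
Proof.
have [a a0 pa] := exists_positive p01 p2_diverges.
have lower (eta : R) : 0 < eta -> exists2 K0, (0 < K0)%N & forall K, (K0 <= K)%N ->
    ((1 - eta)%:E <= completed_prob (PK K) percolates)%E.
  (* [completed_prob_ge] needs the bound [32^-1] and loses a factor [2]. *)
  move=> eta0; have min0 : 0 < Num.min 32^-1 (eta / 2).
    by rewrite lt_min invr_gt0 ltr0n divr_gt0.
  have [T T0 [K0 HK]] := cut_prob_small p01 p2_diverges pa min0.
  exists (maxn 1 K0); first by rewrite leq_max.
  move=> K; rewrite geq_max => /andP[K1 /HK]; rewrite le_min => /andP[c32 ceta].
  have q01 n : 0 <= truncation p K n <= 1.
    by rewrite /truncation; case: ifP; rewrite ?lexx ?ler01.
  apply: le_trans (completed_prob_ge q01 (PK_percolation K K1) a0 T0 c32).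
  by rewrite lee_fin; lra.
split.
  have [|K K0 /(_ K (leqnn K)) HK] := lower 2^-1; first by rewrite invr_gt0.
  by exists K; split=> //; apply: lt_le_trans HK; rewrite lte_fin; lra.
have [K1 _ HK1] := lower 1 ltr01.
have fin K : (K1 <= K)%N -> completed_prob (PK K) percolates \is a fin_num.
  move=> K1K; apply/fin_numPlt; apply/andP; split.
    by apply: lt_le_trans (HK1 K K1K); rewrite ltNyr.
  exact: le_lt_trans (completed_prob_le1 _ _) (ltry _).
apply/fine_cvgP; split; first by exists K1.
apply/cvgrPdist_le => eta eta0; have [K2 _ HK2] := lower eta eta0.
exists (maxn K1 K2) => // K /=; rewrite geq_max => /andP[K1K K2K].
have := HK2 K K2K; have := completed_prob_le1 (PK K) percolates.
rewrite -(fineK (fin K K1K)) !lee_fin /= => h1 h2.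
rewrite ger0_norm; lra.
Qed.
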